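(* For every integer $n\ge1$, the $3$-adic valuation of the denominator $\alpha_{n,2}$ of $A_{n,2}(x)$ is $$\nu_3(\alpha_{n,2})=\begin{cases}\nu_3(n!\,\operatorname{lcm}(1,2,\dots,n))-1 & \text{if } n=2\cdot 3^m\text{ for some integer } m\ge1,\\ \nu_3(n!\,\operatorname{lcm}(1,2,\dots,n)) & \text{otherwise.}\end{cases}$$
   Context: Let $f_0(x)=\ln(1+x^2)$ and $f_n(x)=\int_0^x f_{n-1}(t)\,dt$ for $n\ge1$ ($x$ real). For each $n\ge 0$, $A_{n,2},B_{n,2},C_{n,2}$ denote the (uniquely determined) polynomials with $$f_n(x)=A_{n,2}(x)+B_{n,2}(x)\arctan x+C_{n,2}(x)\ln(1+x^2).$$ Explicitly, $A_{n,2}(x)=\frac{i}{n!}\left[x\varphi_n(x)-\sum_{k=2}^n\frac{x^k\varphi_{n-k+1}(x)}{k(k-1)}\right]$ with $\varphi_m(x)=(x+i)^m-(x-i)^m$, $i=\sqrt{-1}$; it has rational coefficients. The denominator $\alpha_{n,2}$ of $A_{n,2}(x)$ is the least positive integer $d$ such that $d\,A_{n,2}(x)\in\mathbb{Z}[x]$. $\nu_3(m)$ is the exponent of the highest power of $3$ dividing $m$. *)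

(* Defs.v *)
From mathcomp Require Import all_boot all_order all_algebra.
From mathcomp Require Import all_classical all_reals all_analysis.

Set Implicit Arguments.
Unset Strict Implicit.
Unset Printing Implicit Defensive.

Import Order.TTheory GRing.Theory Num.Theory.
Import numFieldNormedType.Exports.

Local Open Scope classical_set_scope.
Local Open Scope ring_scope.

(* Oriented integral from 0 to x; the library only integrates over sets. *)
Definition int_from0 (R : realType) (g : R -> R) (x : R) : R :=
  if 0 <= x then \int[lebesgue_measure]_(t in `[0, x]) g t
  else - \int[lebesgue_measure]_(t in `[x, 0]) g t.

Fixpoint f2 (R : realType) (n : nat) : R -> R :=
  if n is n'.+1 then int_from0 (f2 n') else fun x => ln (1 + x ^+ 2).

Definition decomposes (R : realType) (n : nat) (A B C : {poly R}) : Prop :=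
  forall x : R, f2 n x = A.[x] + B.[x] * atan x + C.[x] * ln (1 + x ^+ 2).

(* The triple (A_{n,2}, B_{n,2}, C_{n,2}); existence and uniqueness of the
   decomposition are not built in, (0, 0, 0) being the value of xget on an
   empty set. *)
Definition ABC2 (R : realType) (n : nat) : {poly R} * {poly R} * {poly R} :=
  xget (0, 0, 0) [set p | decomposes n p.1.1 p.1.2 p.2].

Definition A2 (R : realType) (n : nat) : {poly R} := (ABC2 R n).1.1.

Definition clears_denominators (R : realType) (p : {poly R}) (d : nat) : bool :=
  (0 < d)%N && (d%:R *: p \is a polyOver Num.int).

(* The value is 0 when no d qualifies, i.e. when p is not in Q[x]. *)
Definition denominator (R : realType) (p : {poly R}) : nat :=
  if pselect (exists d, clears_denominators p d) is left h then ex_minn h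
  else 0%N.

Definition alpha2 (R : realType) (n : nat) : nat := denominator (A2 R n).

(* Main.v *)
Require Import Defs.
From mathcomp Require Import all_boot all_order all_algebra.
From mathcomp Require Import all_classical all_reals all_analysis.
From mathcomp Require Import zify ring.

(* Writing (X + i)^n = u_n + i v_n, induction with the fundamental theorem of
   calculus gives C_n = u_n / n!, B_n = 2 v_n / n! and
   A_n' = A_{n-1} - 2 u_{n-1} / n!, A_n(0) = 0; hence the coefficient of
   x^(n-s) in n! A_n is 0 for s odd and +- 2 binom(n, s) (H_n - H_s) for s even,
   H_n being the harmonic numbers. Uniqueness of the decomposition is the
   independence of 1, arctan x and ln (1 + x^2) over the rational functions.

   Let 3^e <= n < 3^(e+1), so that e is the 3-adic valuation of lcm(1, ..., n).
   Only the multiples of 3^e in ]s, n] can contribute valuation -e to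
   H_n - H_s. If n < 2 * 3^e, take s = 0. If n = 2 * 3^e + r with r > 0, then
   1/3^e + 1/(2 * 3^e) loses a factor 3, but s = 3^e + 3^j with j the valuation
   of n keeps only 1/(2 * 3^e), and binom(n, s) is prime to 3. If n = 2 * 3^e,
   every s in [3^e, 2 * 3^e[ other than the odd number 3^e makes binom(n, s)
   divisible by 3, so exactly one factor 3 is lost, the valuation of H_n being
   1 - e. *)

Set Implicit Arguments.
Unset Strict Implicit.
Unset Printing Implicit Defensive.

Import Order.TTheory GRing.Theory Num.Theory.
Import numFieldNormedType.Exports.

(** * Valuations of lcm(1, ..., n) and of sums of its cofactors *)

Definition lcm_upto n := \big[lcmn/1]_(1 <= k < n.+1) k.

(* [lcm(1, ..., n) * binom(n, s) * (H_n - H_s)], a natural number. *)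
Definition binomial_harmonic n s :=
  'C(n, s) * \sum_(s.+1 <= k < n.+1) lcm_upto n %/ k.

Lemma lcm_uptoS n : lcm_upto n.+1 = lcmn (lcm_upto n) n.+1.
Proof. by rewrite /lcm_upto big_nat_recr. Qed.

Lemma lcm_upto_gt0 n : 0 < lcm_upto n.
Proof.
elim: n => [|n IHn]; first by rewrite /lcm_upto big_geq.
by rewrite lcm_uptoS lcmn_gt0 IHn.
Qed.

Lemma dvdn_lcm_upto n k : 0 < k <= n -> k %| lcm_upto n.
Proof.
elim: n => [|n IHn]; first by case: k.
case/andP=> k0; rewrite lcm_uptoS leq_eqVlt => /orP[/eqP->|].
  exact: dvdn_lcmr.
by rewrite ltnS => kn; apply: dvdn_trans (dvdn_lcml _ _); rewrite IHn // k0.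
Qed.

Lemma logn_lcm_upto p n : prime p -> 0 < n -> logn p (lcm_upto n) = trunc_log p n.
Proof.
move=> pp n0; have p1 := prime_gt1 pp; apply/eqP; rewrite eqn_leq; apply/andP; split; last first.
  rewrite -pfactor_dvdn ?lcm_upto_gt0 //; apply: dvdn_lcm_upto.
  by rewrite expn_gt0 (prime_gt0 pp) /= trunc_logP.
elim: n n0 => // n IHn _; rewrite lcm_uptoS logn_lcm ?lcm_upto_gt0 // geq_max.
apply/andP; split; last first.
  by apply: trunc_log_max => //; apply: dvdn_leq => //; rewrite pfactor_dvdnn.
case: n IHn => [_|n IHn]; first by rewrite /lcm_upto big_geq // logn1.
by rewrite (leq_trans (IHn _)) ?leq_trunc_log.
Qed.

Lemma sum_multiples q (F : nat -> nat) s n : 0 < q -> s <= n ->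
  \sum_(s.+1 <= k < n.+1 | q %| k) F k =
  \sum_((s %/ q).+1 <= m < (n %/ q).+1) F (m * q).
Proof.
move=> q0; elim: n => [|n IHn]; first by rewrite leqn0 => /eqP->; rewrite !big_geq ?div0n.
rewrite leq_eqVlt => /orP[/eqP->|]; first by rewrite !big_geq.
rewrite ltnS => sn; rewrite big_mkcond big_nat_recr ?ltnS //= -big_mkcond IHn // divnS //.
case: ifP => /= [qn|_]; last by rewrite addn0 add0n.
rewrite add1n [RHS]big_nat_recr /=; last by rewrite ltnS leq_div2r.
by congr (_ + F _); rewrite -(add1n (_ %/ _)) -[1]/(true : nat) -qn -divnS // divnK.
Qed.

(* Only the multiples of [p ^ a] among the denominators matter modulo
   [p ^ (e - a + 1)], [e] being the valuation of [lcm(1, ..., n)]. *)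
Lemma sum_lcm_upto_mod p a s n : prime p -> a <= trunc_log p n -> s <= n ->
  \sum_(s.+1 <= k < n.+1) lcm_upto n %/ k =
  \sum_((s %/ p ^ a).+1 <= m < (n %/ p ^ a).+1) lcm_upto n %/ (m * p ^ a)
    %[mod p ^ (trunc_log p n - a).+1].
Proof.
move=> pp ae sn; have p0 := prime_gt0 pp.
rewrite -sum_multiples ?expn_gt0 ?p0 //.
rewrite (bigID (fun k => p ^ a %| k)) /= -modnDmr.
(* A dropped [k] has valuation below [a], so its cofactor has valuation above
   [trunc_log p n - a]. *)
suff /eqP -> : p ^ (trunc_log p n - a).+1 %|
  \sum_(s.+1 <= k < n.+1 | ~~ (p ^ a %| k)) lcm_upto n %/ k by rewrite addn0.
rewrite big_nat_cond; apply: dvdn_sum => k /andP[/andP[sk kn] pk].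
have k0 : 0 < k by case: k sk {kn pk}.
have kD : k %| lcm_upto n by rewrite dvdn_lcm_upto // k0.
have Dk0 : 0 < lcm_upto n %/ k by rewrite divn_gt0 // dvdn_leq // lcm_upto_gt0.
rewrite pfactor_dvdn //.
rewrite logn_div // logn_lcm_upto //; last by rewrite -ltnS (leq_trans _ kn).
move: pk; rewrite pfactor_dvdn // -ltnNge; lia.
Qed.

(** * Carries and divisibility of binomial coefficients *)

Lemma logn_fact_widen p n b : prime p -> n <= b ->
  logn p n`! = \sum_(1 <= i < b.+1) n %/ p ^ i.
Proof.
move=> pp nb; rewrite logn_fact //.
rewrite (big_cat_nat (n := n.+1) (p := b.+1)) //= [X in _ = _ + X]big_nat_cond.
rewrite [X in _ = _ + X]big1 ?addn0 // => i /andP[/andP[ni _] _].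
by rewrite divn_small // (leq_trans ni) // ltnW // ltn_expl // prime_gt1.
Qed.

(** Kummer's theorem: the summand at [i] is the carry out of the [i] lowest base-[p] digits of
    [k + (n - k)]. *)
Lemma logn_bin p n k : prime p -> k <= n ->
  logn p 'C(n, k) = \sum_(1 <= i < n.+1) (p ^ i <= k %% p ^ i + (n - k) %% p ^ i).
Proof.
move=> pp kn; have := congr1 (logn p) (bin_fact kn).
rewrite !lognM ?muln_gt0 ?fact_gt0 ?bin_gt0 //.
rewrite !(logn_fact_widen (b := n) pp) ?leq_subr // -big_split /=.
have -> : \sum_(1 <= i < n.+1) n %/ p ^ i =
  \sum_(1 <= i < n.+1) (k %/ p ^ i + (n - k) %/ p ^ i) +
  \sum_(1 <= i < n.+1) (p ^ i <= k %% p ^ i + (n - k) %% p ^ i).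
  rewrite -big_split /=; apply: eq_bigr => i _.
  by rewrite -divnD ?expn_gt0 ?prime_gt0 // subnKC.
by rewrite addnC => /addnI.
Qed.

(** With $N = c p^e$, $p^e$ divides $k \binom{N}{k} = N \binom{N-1}{k-1}$ but not $k$. *)
Lemma dvdn_bin_mul_pexp p e c k : prime p -> 0 < k -> ~~ (p ^ e %| k) ->
  p %| 'C(c * p ^ e, k).
Proof.
case: k => // k pp _ pk.
have [|nk] := posnP 'C(c * p ^ e, k.+1); first by move->.
have n0 : 0 < c * p ^ e by move: nk; case: (c * p ^ e).
have : p ^ e %| k.+1 * 'C(c * p ^ e, k.+1).
  by rewrite -mul_bin_diag dvdn_mulr // dvdn_mull.
rewrite -[X in X %| 'C(_, _)]expn1 !pfactor_dvdn ?muln_gt0 //= lognM //.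
move: pk; rewrite pfactor_dvdn //; lia.
Qed.

(* No carry: [3 ^ e] and [3 ^ j] sit under the leading digit 2 and the last
   nonzero digit of [n]. *)
Lemma logn3_bin_two_digits n e r : 0 < r < 3 ^ e -> n = 2 * 3 ^ e + r ->
  logn 3 'C(n, 3 ^ e + 3 ^ logn 3 n) = 0.
Proof.
move=> /andP[r0 re] nE; set j := logn 3 n.
have n0 : 0 < n by lia.
have jn : 3 ^ j %| n by rewrite pfactor_dvdn.
have je : j < e.
  rewrite ltnNge -pfactor_dvdn // nE dvdn_addr ?dvdn_mull //.
  by apply/negP => /(dvdn_leq r0); lia.
have jr : 3 ^ j <= r.
  apply: dvdn_leq => //; move: jn; rewrite nE dvdn_addr // dvdn_mull //.
  by rewrite dvdn_exp2l // ltnW.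
rewrite logn_bin //; last by lia.
rewrite big_nat_cond big1 // => i /andP[/andP[i1 _] _].
(* Without a borrow in the subtraction there is no carry in the addition. The left residue is 0 if
   [i <= j], and [3 ^ j] if [j < i <= e]; beyond [e] nothing is reduced. *)
suff : (3 ^ e + 3 ^ j) %% 3 ^ i <= n %% 3 ^ i.
  move=> le; apply/eqP; rewrite eqb0 -ltnNge.
  have kn : 3 ^ e + 3 ^ j <= n by lia.
  have i0 : 0 < 3 ^ i by rewrite expn_gt0.
  rewrite modnB //.
  have := ltn_pmod n i0; have := ltn_pmod (3 ^ e + 3 ^ j) i0.
  move: le; lia.
have [ij|ji] := leqP i j.
  by rewrite (eqP (_ : 3 ^ i %| _)) // dvdn_add // dvdn_exp2l // (leq_trans ij) // ltnW.
have [ie|ei] := leqP i e.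
  have /eqP eE : 3 ^ i %| 3 ^ e by rewrite dvdn_exp2l.
  rewrite -modnDml eE add0n modn_small ?ltn_exp2l //.
  apply: dvdn_leq.
    rewrite lt0n -/(dvdn _ _) pfactor_dvdn // -/j; lia.
  by rewrite /dvdn modn_dvdm ?dvdn_exp2l 1?ltnW // -/(dvdn _ _).
have e3 : 3 ^ e.+1 <= 3 ^ i by rewrite leq_exp2l.
by rewrite expnS in e3; rewrite !modn_small //; lia.
Qed.

(** * Divisibility of [binomial_harmonic] by 3 *)

Lemma logn_lt_of_remainder p c e r : prime p -> 0 < r < p ^ e ->
  logn p (c * p ^ e + r) < e.
Proof.
move=> pp /andP[r0 re]; rewrite ltnNge -pfactor_dvdn //; last by lia.
rewrite dvdn_addr ?dvdn_mull //; apply/negP => /(dvdn_leq r0); lia.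
Qed.

Lemma dvdn_sum_lcm_upto p n s : prime p -> s <= n ->
  p %| \sum_((s %/ p ^ trunc_log p n).+1 <= m < (n %/ p ^ trunc_log p n).+1)
         lcm_upto n %/ (m * p ^ trunc_log p n) =
  (p %| \sum_(s.+1 <= k < n.+1) lcm_upto n %/ k).
Proof.
move=> pp sn; have := sum_lcm_upto_mod pp (leqnn _) sn.
by rewrite subnn expn1 /dvdn => ->.
Qed.

Lemma prime_ndvdn_lcm_upto_div p n c : prime p -> 0 < c -> ~~ (p %| c) ->
  c * p ^ trunc_log p n <= n -> ~~ (p %| lcm_upto n %/ (c * p ^ trunc_log p n)).
Proof.
move=> pp c0 pc cn; have q0 : 0 < c * p ^ trunc_log p n.
  by rewrite muln_gt0 c0 expn_gt0 prime_gt0.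
have qD : c * p ^ trunc_log p n %| lcm_upto n by rewrite dvdn_lcm_upto ?q0.
have Dq : 0 < lcm_upto n %/ (c * p ^ trunc_log p n).
  by rewrite divn_gt0 // dvdn_leq // lcm_upto_gt0.
have n0 : 0 < n by apply: leq_trans cn.
rewrite -[X in X %| _]expn1 pfactor_dvdn // -ltnNge logn_div // logn_lcm_upto //.
rewrite lognM // ?expn_gt0 ?prime_gt0 // pfactorK //; lia.
Qed.

(** The case [m = 0] is excluded too: for $n = 2$ the only candidate is $s = 0$, where the value is
    3. *)
Lemma binomial_harmonic_ndvd3 n : 0 < n -> (forall m, n <> 2 * 3 ^ m) ->
  exists s, [/\ s < n, ~~ odd s & ~~ (3 %| binomial_harmonic n s)].
Proof.
move=> n0 n23; set e := trunc_log 3 n.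
have q0 : 0 < 3 ^ e by rewrite expn_gt0.
have /andP[qn nq] := trunc_log_bounds (isT : 1 < 3) n0.
rewrite -/e expnS in qn nq.
have /orP[/eqP c1|/eqP c2] : (n %/ 3 ^ e == 1) || (n %/ 3 ^ e == 2).
  have : 1 <= n %/ 3 ^ e by rewrite divn_gt0.
  have : n %/ 3 ^ e < 3 by rewrite ltn_divLR.
  lia.
- exists 0; split=> //; rewrite /binomial_harmonic bin0 mul1n.
  rewrite -dvdn_sum_lcm_upto // -/e c1 div0n big_nat1.
  by rewrite prime_ndvdn_lcm_upto_div // mul1n.
have nE := divn_eq n (3 ^ e); rewrite c2 in nE.
have r0 : 0 < n %% 3 ^ e by rewrite lt0n; apply/eqP => r0; move: nE; rewrite r0 addn0; apply: n23.
have rq : n %% 3 ^ e < 3 ^ e by rewrite ltn_pmod.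
have r0q : 0 < n %% 3 ^ e < 3 ^ e by rewrite r0.
have je : logn 3 n < e by rewrite [n]nE logn_lt_of_remainder.
have jq : 3 ^ logn 3 n < 3 ^ e by rewrite ltn_exp2l.
(* Two odd powers have an even sum. Its quotient by [3 ^ e] is 1, which leaves only the term of
   [2 * 3 ^ e]. *)
exists (3 ^ e + 3 ^ logn 3 n); split; first by lia.
  by rewrite oddD !oddX !orbT.
rewrite Euclid_dvdM // negb_or; apply/andP; split.
  rewrite -[X in X %| _]expn1 pfactor_dvdn ?bin_gt0 //; last by lia.
  by rewrite (logn3_bin_two_digits r0q).
rewrite -dvdn_sum_lcm_upto //; last by lia.
rewrite -/e c2 divnDl // divnn q0 divn_small // addn0 big_nat1.
by rewrite prime_ndvdn_lcm_upto_div // -/e [leqRHS]nE leq_addr.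
Qed.

Lemma trunc_log_double_pexp3 e : trunc_log 3 (2 * 3 ^ e) = e.
Proof. by apply: trunc_log_eq => //; rewrite expnS leq_pmull // ltn_pmul2r // expn_gt0. Qed.

Lemma binomial_harmonic_dvd3 e s : s < 2 * 3 ^ e -> ~~ odd s ->
  3 %| binomial_harmonic (2 * 3 ^ e) s.
Proof.
move=> sn es; have q0 : 0 < 3 ^ e by rewrite expn_gt0.
have [sq|qs] := ltnP s (3 ^ e); last first.
  apply: dvdn_mulr; apply: dvdn_bin_mul_pexp => //; first by lia.
  apply/negP => /dvdnP[[|[|c]] sE]; [by lia| |by lia].
  by move: es; rewrite sE mul1n oddX orbT.
apply: dvdn_mull; rewrite -dvdn_sum_lcm_upto ?trunc_log_double_pexp3 1?ltnW //.
rewrite mulnK // divn_small // 2?big_ltn // big_geq //.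
set D := lcm_upto _.
(* The two surviving terms are $2x$ and $x$. *)
have /dvdnP[x ->] : 2 * 3 ^ e %| D by rewrite dvdn_lcm_upto // leqnn andbT; lia.
rewrite mulnK; last by lia.
have -> : x * (2 * 3 ^ e) = x * 2 * (1 * 3 ^ e) by lia.
rewrite mulnK; last by lia.
by rewrite addn0 (_ : _ + x = 3 * x) ?dvdn_mulr //; lia.
Qed.

(** Modulo 9 only the denominators $m 3^e$ with $m \le 6$ matter. Since 60 = lcm(1, ..., 6), all
    their cofactors are multiples of $x$, the quotient of the full lcm by $60 \cdot 3^e$; it is
    prime to 3, both having valuation $e + 1$. *)
Lemma logn_binomial_harmonic0 e : logn 3 (binomial_harmonic (2 * 3 ^ e.+1) 0) = 1.
Proof.
set n := 2 * 3 ^ e.+1; have q0 : 0 < 3 ^ e by rewrite expn_gt0.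
have tl : trunc_log 3 n = e.+1 by apply: trunc_log_double_pexp3.
have nE : n = 6 * 3 ^ e by rewrite /n expnS; lia.
rewrite /binomial_harmonic bin0 mul1n.
have := @sum_lcm_upto_mod 3 e 0 n isT _ (leq0n _).
rewrite tl subSnn => /(_ (leqnSn _)); rewrite nE mulnK // div0n.
have DK c : 0 < c <= 6 -> c * 3 ^ e %| lcm_upto (6 * 3 ^ e).
  by case/andP=> c0 c6; rewrite dvdn_lcm_upto // muln_gt0 c0 q0 leq_pmul2r.
have /dvdnP[x xE] : 60 * 3 ^ e %| lcm_upto (6 * 3 ^ e).
  have /dvdnP[y yE] := DK 1 isT; rewrite mul1n in yE.
  have dy c : 0 < c <= 6 -> c %| y by move=> /DK; rewrite yE dvdn_pmul2r.
  rewrite yE dvdn_pmul2r // (_ : 60 = 3 * (4 * 5)) //.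
  by rewrite !Gauss_dvd // !dy.
have x3 : ~~ (3 %| x).
  have x0 : 0 < x by move: (lcm_upto_gt0 (6 * 3 ^ e)); rewrite xE; case: (x).
  have := @logn_lcm_upto 3 n isT; rewrite tl nE xE muln_gt0 q0 => /(_ isT).
  rewrite !lognM ?muln_gt0 ?q0 // pfactorK // (_ : logn 3 60 = 1) //.
  by rewrite -[X in X %| _]expn1 pfactor_dvdn //; lia.
set S := (\sum_(_ <= _ < (6 * 3 ^ e).+1) _).
(* 60 + 30 + 20 + 15 + 12 + 10 = 3 * 49 *)
rewrite 6?big_ltn // big_geq // xE.
have Dq c d : 0 < c -> c * d = 60 -> (x * (60 * 3 ^ e)) %/ (c * 3 ^ e) = d * x.
  move=> c0 cd; have -> : x * (60 * 3 ^ e) = d * x * (c * 3 ^ e) by rewrite -cd; lia.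
  by rewrite mulnK // muln_gt0 c0.
rewrite (Dq 1 60) // (Dq 2 30) // (Dq 3 20) // (Dq 4 15) // (Dq 5 12) // (Dq 6 10) //.
move=> SE.
(* As [logn 3 0] is 0, the value $S = 0$ is ruled out separately, by $S \equiv 147 x$ modulo 9. *)
have [s0|S0] := posnP S; first by move: SE; rewrite s0; lia.
apply/eqP; rewrite eqn_leq; apply/andP; split.
  by rewrite leqNgt -pfactor_dvdn //; move: SE x3; lia.
by rewrite -pfactor_dvdn //; move: SE; lia.
Qed.

(* [d] is a common denominator of the coefficients
   [+- 2 binom(n, s) (H_n - H_s) / n!] of [A_{n,2}]. *)
Definition clears n d :=
  forall s, s < n -> ~~ odd s -> n`! * lcm_upto n %| 2 * d * binomial_harmonic n s.

(** The clearing integers are closed under gcd, so minimality gives [a <= gcdn a d]. *)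
Lemma dvdn_min_clears n a d : 0 < a -> clears n a ->
  (forall b, 0 < b -> clears n b -> a <= b) -> clears n d -> a %| d.
Proof.
move=> a0 ca amin cd; apply/gcdn_idPl/eqP; rewrite eqn_leq dvdn_leq ?dvdn_gcdl //=.
apply: amin => [|s sn es]; first by rewrite gcdn_gt0 a0.
by rewrite muln_gcdr muln_gcdl dvdn_gcd ca ?cd.
Qed.

Lemma logn3_min_clears n a : 0 < n -> 0 < a -> clears n a ->
  (forall b, 0 < b -> clears n b -> a <= b) ->
  ((exists m, 1 <= m /\ n = 2 * 3 ^ m) ->
     logn 3 a = logn 3 (n`! * lcm_upto n) - 1) /\
  (~ (exists m, 1 <= m /\ n = 2 * 3 ^ m) ->
     logn 3 a = logn 3 (n`! * lcm_upto n)).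
Proof.
move=> n0 a0 ca amin; set V := n`! * lcm_upto n.
have V0 : 0 < V by rewrite muln_gt0 fact_gt0 lcm_upto_gt0.
have aV : a %| V.
  by apply: dvdn_min_clears amin _ => // s _ _; rewrite -mulnA dvdn_mull // dvdn_mulr.
have low s : s < n -> ~~ odd s -> 0 < binomial_harmonic n s ->
    logn 3 V <= logn 3 a + logn 3 (binomial_harmonic n s).
  move=> sn es b0; have a20 : 0 < 2 * a by rewrite muln_gt0.
  have := dvdn_leq_log 3 _ (ca s sn es); rewrite muln_gt0 a20 b0 => /(_ isT).
  by rewrite (lognM 3 a20 b0) (lognM 3 (isT : 0 < 2) a0).
have up : logn 3 a <= logn 3 V by apply: dvdn_leq_log.
split=> [[[|m] [// _ nE]]|nn].
  have b1 : logn 3 (binomial_harmonic n 0) = 1 by rewrite nE logn_binomial_harmonic0.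
  have b0 : 0 < binomial_harmonic n 0 by move: b1; case: (binomial_harmonic n 0).
  (* $W = V/3$ still clears, because 3 divides every relevant [binomial_harmonic n s]; [low] at $s =
     0$ forbids losing more. *)
  have /dvdnP[W WE] : 3 %| V.
    rewrite dvdn_mull // dvdn_lcm_upto // nE expnS.
    by have : 0 < 3 ^ m by [rewrite expn_gt0]; lia.
  have W0 : 0 < W by move: V0; rewrite WE; case: (W).
  have cW : clears n W.
    move=> s sn es; rewrite -/V WE.
    have /dvdnP[y ->] : 3 %| binomial_harmonic n s.
      by rewrite nE binomial_harmonic_dvd3 // -nE.
    by rewrite mulnA dvdn_pmul2r // dvdn_mulr // dvdn_mull.
  have := dvdn_leq_log 3 W0 (dvdn_min_clears a0 ca amin cW).
  have := low 0 n0 isT b0; rewrite b1.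
  have -> : logn 3 V = (logn 3 W).+1 by rewrite WE lognM // addn1.
  by lia.
(* Here $n = 2 \cdot 3^0$ escapes [binomial_harmonic_ndvd3], but $V = 4$ is prime to 3 and [up]
   suffices. *)
have [n2|n2] := eqVneq n 2.
  have V2 : logn 3 V = 0.
    by rewrite /V n2 !lcm_uptoS /lcm_upto big_geq.
  by lia.
have [m nE|s [sn es s3]] := @binomial_harmonic_ndvd3 n n0.
  by case: m nE => [|m] nE; [move: n2; rewrite nE|case: nn; exists m.+1].
have b0 : 0 < binomial_harmonic n s by move: s3; case: (binomial_harmonic n s).
have := low s sn es b0.
have -> : logn 3 (binomial_harmonic n s) = 0.
  by move: s3; rewrite -[X in X %| _]expn1 pfactor_dvdn //; lia.
by lia.
Qed.

(** * Explicit decomposition of [f2 n] and its uniqueness *)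

Section Decomposition.
Local Open Scope ring_scope.

(* Real and imaginary parts of [(X + i) ^ n]. *)
Fixpoint Xi_exp (R : nzRingType) (n : nat) : {poly R} * {poly R} :=
  if n is m.+1 then let p := Xi_exp R m in ('X * p.1 - p.2, 'X * p.2 + p.1)
  else (1, 0).

Lemma Xi_exp0 (R : nzRingType) : Xi_exp R 0 = (1, 0). Proof. by []. Qed.

Lemma Xi_expS (R : nzRingType) n :
  ((Xi_exp R n.+1).1 = 'X * (Xi_exp R n).1 - (Xi_exp R n).2) *
  ((Xi_exp R n.+1).2 = 'X * (Xi_exp R n).2 + (Xi_exp R n).1).
Proof. by []. Qed.

(** Real and imaginary parts of $((X+i)^{n+1})' = (n+1)(X+i)^n$. *)
Lemma deriv_Xi_exp (R : comNzRingType) n :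
  ((Xi_exp R n.+1).1^`() = (Xi_exp R n).1 *+ n.+1) *
  ((Xi_exp R n.+1).2^`() = (Xi_exp R n).2 *+ n.+1).
Proof.
elim: n => [|n [IH1 IH2]].
  split; rewrite Xi_expS Xi_exp0 /= ?mulr0 ?mulr1 ?subr0 ?add0r ?derivX ?(derivC 1) //.
rewrite !(mulrSr _ n.+1) !(Xi_expS R n.+1); split.
  rewrite derivB derivM derivX mul1r IH1 IH2 mulrnAr.
  by rewrite [in X in _ = X *+ _ + _](Xi_expS R n) mulrnBl; ring.
rewrite derivD derivM derivX mul1r IH1 IH2 mulrnAr.
by rewrite [in X in _ = X *+ _ + _](Xi_expS R n) mulrnDl; ring.
Qed.

(** Real part of $(X-i)(X+i)^{n+1} = (1+X^2)(X+i)^n$. *)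
Lemma Xi_exp_mulXBi (R : comNzRingType) n :
  'X * (Xi_exp R n.+1).1 + (Xi_exp R n.+1).2 = (1 + 'X^2) * (Xi_exp R n).1.
Proof. by rewrite !Xi_expS; ring. Qed.

(** Real part of the binomial expansion, the last factor being the real part of $i^{n-j}$. For $j >
    n$ the binomial vanishes, so truncated subtraction is harmless. *)
Lemma coef_Xi_exp1 (R : numFieldType) n j :
  (Xi_exp R n).1`_j = 'C(n, j)%:R * (Xi_exp R (n - j)).1`_0.
Proof.
elim: j n => [|j IHj] [|n]; rewrite ?bin0 ?mul1r ?subn0 //.
  by rewrite coef1 bin0n mul0r.
rewrite subSS; apply: (mulIf (_ : j.+1%:R != 0)); first by rewrite pnatr_eq0.
rewrite mulr_natr -coef_deriv deriv_Xi_exp coefMn IHj.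
by rewrite -[LHS]mulr_natl mulrA -natrM (mul_bin_diag n.+1) natrM -[LHS]mulrA mulrC.
Qed.

Lemma coef0_Xi_exp1 (R : nzRingType) m :
  (Xi_exp R m).1`_0 = if odd m then 0 else (-1) ^+ m./2.
Proof.
have S k : (Xi_exp R k.+2).1`_0 = - (Xi_exp R k).1`_0.
  by rewrite !Xi_expS coefB coefD !coefXM /= !sub0r add0r.
elim/ltn_ind: m => [[|[|m]]] IH; first by rewrite coef1.
  by rewrite Xi_expS Xi_exp0 coefB coefXM coef0 subr0.
by rewrite S IH // /= negbK; case: odd; rewrite ?oppr0 // exprS mulN1r.
Qed.

(** Closed form of $A_n$; the inner sum is $H_n - H_{n-j}$. *)
Definition A_poly (R : numFieldType) n : {poly R} :=
  n`!%:R^-1 *: \poly_(j < n.+1)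
    (- 2 * (Xi_exp R n).1`_j * \sum_((n - j).+1 <= k < n.+1) k%:R^-1).

(** The last harmonic term $1/(n+1)$ produces the subtracted polynomial; the rest of the sum gives
    $A_n$. *)
Lemma deriv_A_poly (R : numFieldType) n :
  (A_poly R n.+1)^`() = A_poly R n - (2 / n.+1`!%:R) *: (Xi_exp R n).1.
Proof.
apply/polyP => j; rewrite coef_deriv coefB !coefZ !coef_poly ltnS.
have n0 : n`!%:R != 0 :> R by rewrite pnatr_eq0 -lt0n fact_gt0.
case: ltnP => jn; last first.
  rewrite [X in _ - _ * X]coef_Xi_exp1 bin_small // mul0r.
  by rewrite !mulr0 mul0rn subr0.
have E : (Xi_exp R n.+1).1`_j.+1 * j.+1%:R = n.+1%:R * (Xi_exp R n).1`_j.
  by rewrite mulr_natr -coef_deriv deriv_Xi_exp coefMn mulr_natl.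
move: ((Xi_exp R n.+1).1`_j.+1) E => u E.
rewrite subSS big_nat_recr /=; last by rewrite ltnS leq_subr.
rewrite factS natrM -[LHS]mulr_natr.
have n1 : n.+1%:R != 0 :> R by rewrite pnatr_eq0.
set S := \sum_(_ <= _ < _) _.
transitivity (- 2 * (n.+1%:R * n`!%:R)^-1 * (u * j.+1%:R) * (S + n.+1%:R^-1)).
  by ring.
by rewrite E; field; rewrite n0 addrC natr1 n1.
Qed.

Lemma A_poly0 (R : numFieldType) n : (A_poly R n)`_0 = 0.
Proof. by rewrite coefZ coef_poly /= subn0 big_geq // !mulr0. Qed.

Lemma is_derive_combination (R : realType) (A B C : {poly R}) (x : R) :
  is_derive x 1 (fun y => A.[y] + B.[y] * atan y + C.[y] * ln (1 + y ^+ 2))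
    (A^`().[x] + B^`().[x] * atan x + C^`().[x] * ln (1 + x ^+ 2) +
     (B.[x] + 2 * x * C.[x]) / (1 + x ^+ 2)).
Proof.
have x0 : 0 < 1 + x ^+ 2 by rewrite ltr_pwDl // sqr_ge0.
have dw : is_derive x 1 (fun y : R => 1 + y ^+ 2) (2 * x).
  have -> : (fun y : R => 1 + y ^+ 2) = horner (1 + 'X^2).
    by apply/funext => y; rewrite !hornerE.
  apply: is_derive_eq.
  by rewrite derivD derivXn (derivC 1) !hornerE mulr_natl.
have dl : is_derive x 1 (fun y : R => ln (1 + y ^+ 2)) ((1 + x ^+ 2)^-1 * (2 * x)).
  exact: (@is_derive1_comp _ (@ln R) (fun y => 1 + y ^+ 2) x _ _ (is_derive1_ln x0) dw).
have dA := is_derive_poly A x.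
have dB := is_derive_poly B x.
have dC := is_derive_poly C x.
have := is_deriveD (is_deriveD dA (is_deriveM dB (is_derive1_atan x))) (is_deriveM dC dl).
move=> h; apply: (is_derive_eq h); rewrite /GRing.scale /=; field.
by rewrite gt_eqF.
Qed.

Lemma continuous_combination (R : realType) (A B C : {poly R}) :
  continuous (fun y => A.[y] + B.[y] * atan y + C.[y] * ln (1 + y ^+ 2)).
Proof.
move=> x; apply: differentiable_continuous; apply/derivable1_diffP.
by case: (is_derive_combination A B C x).
Qed.

(** The fundamental theorem of calculus needs a nondegenerate interval, hence three cases on the
    sign of [x]. *)
Lemma int_from0_antiderivative (R : realType) (F g : R -> R) (x : R) :
  (forall y : R, is_derive y 1 F (g y)) -> continuous g -> F 0 = 0 ->
  int_from0 g x = F x.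
Proof.
move=> dF cg F0.
have cF (y : R) : {for y, continuous F}.
  apply: differentiable_continuous; apply/derivable1_diffP; by case: (dF y).
have FTC a b : a < b -> \int[lebesgue_measure]_(t in `[a, b]%classic) g t = F b - F a.
  move=> ab; rewrite /Rintegral (@continuous_FTC2 _ g F) //.
  - exact: continuous_subspaceT.
  - split; first by move=> y _; case: (dF y).
    + exact: cvg_at_right_filter (cF a).
    + exact: cvg_at_left_filter (cF b).
  - by move=> y _; rewrite derive1E; apply: derive_val.
rewrite /int_from0; case: ltgtP => x0; first by rewrite FTC // F0 subr0.
  by rewrite FTC // F0 sub0r opprK.
by rewrite -x0 set_itv1 Rintegral_set1 F0.
Qed.

Lemma f2_decomposes (R : realType) n :
  decomposes n (A_poly R n) ((2 / n`!%:R) *: (Xi_exp R n).2)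
    (n`!%:R^-1 *: (Xi_exp R n).1).
Proof.
elim: n => [|n IH] x.
  rewrite /A_poly Xi_exp0 poly_def big_ord_recl big_ord0 subnn big_geq //=.
  by rewrite !(mulr0, scale0r, scaler0, addr0, horner0, mul0r, add0r, invr1, scale1r, hornerC, mul1r).
have f2E : f2 n = fun x => (A_poly R n).[x] +
    ((2 / n`!%:R) *: (Xi_exp R n).2).[x] * atan x +
    (n`!%:R^-1 *: (Xi_exp R n).1).[x] * ln (1 + x ^+ 2) by apply/funext.
have n0 : n`!%:R != 0 :> R by rewrite pnatr_eq0 -lt0n fact_gt0.
have n1 : n.+1%:R != 0 :> R by rewrite pnatr_eq0.
rewrite [f2 _]/(int_from0 (f2 n)).
apply: (int_from0_antiderivative (F := fun x => (A_poly R n.+1).[x] +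
    ((2 / n.+1`!%:R) *: (Xi_exp R n.+1).2).[x] * atan x +
    (n.+1`!%:R^-1 *: (Xi_exp R n.+1).1).[x] * ln (1 + x ^+ 2))).
- move=> y; have y0 : 1 + y ^+ 2 != 0 by rewrite gt_eqF // ltr_pwDl // sqr_ge0.
  apply: (is_derive_eq (is_derive_combination _ _ _ y)).
  rewrite f2E; move: (deriv_A_poly R n) (deriv_Xi_exp R n) (Xi_exp_mulXBi R n).
  move: (A_poly R n.+1) (Xi_exp R n.+1).1 (Xi_exp R n.+1).2
    (A_poly R n) (Xi_exp R n).1 (Xi_exp R n).2 => A1 u1 v1 A u v dA [du dv] E.
  have {}E := congr1 (horner^~ y) E; rewrite /= !hornerE in E.
  rewrite dA !derivZ du dv !hornerE !hornerMn.
  (* This makes $(B_{n+1} + 2yC_{n+1})/(1+y^2)$ equal to $2u_n/(n+1)!$, which cancels the correction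
     in $A_{n+1}'$. *)
  have -> : v1.[y] = (1 + y ^+ 2) * u.[y] - y * u1.[y] by rewrite -E; ring.
  rewrite factS natrM -(mulr_natr v.[y]) -(mulr_natr u.[y]) /=; field.
  by rewrite n0 y0 addrC natr1 n1.
- by rewrite f2E; apply: continuous_combination.
- by rewrite horner_coef0 A_poly0 atan0 expr0n /= addr0 ln1 !mulr0 !addr0.
Qed.

(** * Independence of 1, arctan x and ln(1 + x^2) *)

Lemma poly_eq0_everywhere (R : realType) (p : {poly R}) :
  (forall x, p.[x] = 0) -> p = 0.
Proof.
move=> p0; apply: (@roots_geq_poly_eq0 _ _ [seq i%:R | i <- iota 0 (size p)]).
- by apply/allP => x _; rewrite /root p0.
- by rewrite map_inj_uniq ?iota_uniq // => i j /eqP; rewrite eqr_nat => /eqP.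
- by rewrite size_map size_iota.
Qed.

(* With [W = 1 + X^2], the hypothesis says that [(b + 2 c X) / W] is the
   derivative of the rational function [- P / W ^ k]. *)
Lemma no_rational_primitive (R : numFieldType) (P : {poly R}) k (b c : R) :
  P^`() * (1 + 'X^2) - (2 * k)%:R * 'X * P +
    (1 + 'X^2) ^+ k * (b%:P + 2 * 'X * c%:P) = 0 -> b = 0 /\ c = 0.
Proof.
set W : {poly R} := 1 + 'X^2.
have sW : size W = 3%N.
  by rewrite /W addrC size_polyDl ?size_polyXn ?size_poly1.
have W0 : W != 0 by rewrite -size_poly_eq0 sW.
have dW : W^`() = 2 * 'X by rewrite /W derivD derivXn (derivC 1) add0r mulr_natl.
elim: k P => [|k IHk] P.
  rewrite muln0 !mul0r subr0 mul1r => E.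
  have cE : 2 * 'X * c%:P = (2 * c)%:P * 'X by rewrite polyCM polyC_natr; ring.
  (* Otherwise $P' W$ would have degree at least 2, against at most 1 for $b + 2cX$. *)
  have P0 : P^`() = 0.
    apply/eqP; apply/negPn/negP => P0.
    have := congr1 (fun p : {poly R} => size p) (addr0_eq E).
    rewrite size_polyN size_mul // sW cE addrC size_MXaddC size_polyC.
    rewrite -size_poly_gt0 in P0.
    by case: ifP => _; case: (2 * c != 0); case: (size _) P0 => [|d] //=; rewrite addn3.
  move: E; rewrite P0 mul0r add0r cE => E.
  have := congr1 (coefp 0) E; have := congr1 (coefp 1) E.
  rewrite /= !coefD !coefMX !coefC /= !add0r addr0 => /eqP.
  by rewrite mulf_eq0 pnatr_eq0 => /eqP-> ->.
move=> E.
(* Modulo $W$ the equation reads $2(k+1) X P = 0$, and $X$ is invertible since $X^2 = -1$. *)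
have /dvdpP[Q PQ] : W %| P.
  have k0 : (2 * k.+1)%:R != 0 :> R by rewrite pnatr_eq0.
  have WXP : W %| 'X * P.
    rewrite -(dvdpZr _ _ k0) -mul_polyC polyC_natr mulrA; apply/dvdpP.
    exists (P^`() + W ^+ k * (b%:P + 2 * 'X * c%:P)).
    by apply/eqP; rewrite -subr_eq0 -oppr_eq0; apply/eqP; rewrite -[RHS]E exprS; ring.
  have -> : P = W * P - 'X * ('X * P) by rewrite /W; ring.
  by apply: dvdp_sub; [apply: dvdp_mulIl | apply: dvdp_mull].
apply: (IHk Q); apply: (mulIf W0); rewrite mul0r -[RHS]E PQ derivM dW exprS.
by rewrite !mulnS !natrD; ring.
Qed.

(* The factor [(1 + x^2) ^ k] makes the statement stable under
   differentiation, which lowers the degrees of [B] and [C]. *)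
Lemma atan_ln_independent (R : realType) m k (P B C : {poly R}) :
  (size B <= m)%N -> (size C <= m)%N ->
  (forall x, P.[x] + (1 + x ^+ 2) ^+ k * (B.[x] * atan x + C.[x] * ln (1 + x ^+ 2)) = 0) ->
  B = 0 /\ C = 0.
Proof.
elim: m k P B C => [|m IHm] k P B C sB sC H.
  by split; apply/eqP; rewrite -size_poly_leq0.
set W : {poly R} := 1 + 'X^2.
have WE x : W.[x] = 1 + x ^+ 2 by rewrite !hornerE.
have dW : W^`() = 2 * 'X by rewrite /W derivD derivXn (derivC 1) add0r mulr_natl.
have dWk : (W ^+ k)^`() * W = (2 * k)%:R * 'X * W ^+ k.
  rewrite deriv_exp dW; case: (k) => [|i]; first by rewrite mulr0n muln0 !mul0r.
  by rewrite -(mulr_natr (2 * 'X * _)) natrM exprS /=; ring.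
(* Differentiating, multiplying by $W$ and replacing $W^k (B \arctan x + C \ln(1+x^2))$ by $-P$
   leaves this rational part. *)
set P1 := P^`() * W - (2 * k)%:R * 'X * P + W ^+ k * (B + 2 * 'X * C).
have H1 x : P1.[x] + (1 + x ^+ 2) ^+ k.+1 *
    (B^`().[x] * atan x + C^`().[x] * ln (1 + x ^+ 2)) = 0.
  have x0 : 1 + x ^+ 2 != 0 by rewrite gt_eqF // ltr_pwDl // sqr_ge0.
  have := is_derive_combination P (W ^+ k * B) (W ^+ k * C) x.
  have -> : (fun y => P.[y] + (W ^+ k * B).[y] * atan y +
      (W ^+ k * C).[y] * ln (1 + y ^+ 2)) = cst 0.
    by apply/funext => y; rewrite /= -(H y) !hornerM horner_exp WE; ring.
  move=> h; have := @derive_val _ _ _ _ _ _ _ h.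
  rewrite derive_cst => E.
  rewrite -[RHS](mulr0 (1 + x ^+ 2)) E.
  have natx i : (i%:R : {poly R}).[x] = i%:R by rewrite -polyC_natr hornerC.
  have D := congr1 (horner^~ x) dWk.
  rewrite /= !hornerM hornerX WE natx horner_exp WE in D.
  have Hx := H x.
  rewrite /P1; clear P1; clearbody W.
  rewrite !derivM !(WE, natx, hornerD, hornerN, hornerM, hornerX, horner_exp).
  move: ((W ^+ k)^`().[x]) D => w' D.
  apply/eqP; rewrite -subr_eq0; apply/eqP.
  move: Hx x0 D; rewrite [_ ^+ k.+1]exprS.
  move: (1 + x ^+ 2) ((1 + x ^+ 2) ^+ k) => w wk Hx x0 D.
  rewrite -(mulr0 (- ((2 * k)%:R * x))) -Hx.
  transitivity (- ((2 * k)%:R * x * P.[x]) -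
    (w' * w) * (B.[x] * atan x + C.[x] * ln w)); first by field.
  by rewrite D; ring.
have sd (p : {poly R}) : (size p <= m.+1)%N -> (size p^`() <= m)%N.
  move=> sp; have [->|p0] := eqVneq p 0; first by rewrite deriv0 size_poly0.
  by have := lt_size_deriv p0; lia.
have [B0 C0] := IHm _ _ _ _ (sd _ sB) (sd _ sC) H1.
have const (p : {poly R}) : p^`() = 0 -> p = (p`_0)%:P.
  move=> p0; apply/polyP => -[|i]; rewrite coefC //=.
  have := coef_deriv p i; rewrite p0 coef0 => /esym/eqP.
  by rewrite mulrn_eq0 /= => /eqP.
(* Now $B$ and $C$ are constants, and $P_1 = 0$ is the hypothesis of [no_rational_primitive]. *)
have P10 : P1 = 0.
  apply: poly_eq0_everywhere => x; have := H1 x.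
  by rewrite B0 C0 !horner0 !mul0r addr0 mulr0 addr0.
have [|b0 c0] := @no_rational_primitive R P k B`_0 C`_0.
  by rewrite -(const B B0) -(const C C0).
by rewrite (const B B0) (const C C0) b0 c0.
Qed.

(** The difference of two decompositions is a relation to which [atan_ln_independent] applies with
    [k = 0]. *)
Lemma A2E (R : realType) n : A2 R n = A_poly R n.
Proof.
suff E : ABC2 R n =
    (A_poly R n, (2 / n`!%:R) *: (Xi_exp R n).2, n`!%:R^-1 *: (Xi_exp R n).1).
  by rewrite /A2 E.
apply: xget_unique; first exact: f2_decomposes.
move=> [[A B] C] /= D; have D0 := @f2_decomposes R n.
move: (A_poly R n) (_ *: _) (_ *: _) D0 => A0 C0 B0 D0.
have H x : (A - A0).[x] + (1 + x ^+ 2) ^+ 0 *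
    ((B - B0).[x] * atan x + (C - C0).[x] * ln (1 + x ^+ 2)) = 0.
  have : f2 n x = f2 n x by [].
  rewrite {1}D D0 => /eqP; rewrite -subr_eq0 => /eqP E.
  by rewrite -[RHS]E !(hornerD, hornerN); ring.
have [BE CE] := atan_ln_independent (leq_maxl _ _) (leq_maxr _ _) H.
have AE : A - A0 = 0.
  apply: poly_eq0_everywhere => x.
  by have := H x; rewrite BE CE !horner0 !mul0r addr0 mulr0 addr0.
by congr (_, _, _); apply/eqP; rewrite -subr_eq0 ?AE ?BE ?CE.
Qed.
End Decomposition.

(** * From polynomial coefficients to the denominator *)

Section Denominator.
Local Open Scope ring_scope.

Lemma ratio_intE (R : archiRealFieldType) a b : (0 < b)%N ->
  (a%:R / b%:R : R) \is a Num.int = (b %| a)%N.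
Proof.
move=> b0; have bR : b%:R != 0 :> R by rewrite pnatr_eq0 -lt0n.
rewrite intrEge0 ?divr_ge0 ?ler0n //; apply/idP/idP => [/natrP[m E]|/dvdnP[m ->]].
  apply/dvdnP; exists m; apply/eqP.
  by rewrite -(eqr_nat R) natrM -E divfK.
by rewrite natrM mulfK // natr_nat.
Qed.

(** Indexing by [n - s] isolates the real part of $i^s$, which is 0 for odd [s] and a sign for even
    [s]. *)
Lemma coef_A_poly (R : numFieldType) n s : (s <= n)%N ->
  (A_poly R n)`_(n - s) = - (Xi_exp R s).1`_0 *
    ((2 * binomial_harmonic n s)%:R / (n`! * lcm_upto n)%:R).
Proof.
move=> sn; rewrite coefZ coef_poly ltnS leq_subr coef_Xi_exp1 subKn // bin_sub //.
have D0 : (lcm_upto n)%:R != 0 :> R by rewrite pnatr_eq0 -lt0n lcm_upto_gt0.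
have n0 : n`!%:R != 0 :> R by rewrite pnatr_eq0 -lt0n fact_gt0.
have -> : \sum_(s.+1 <= k < n.+1) k%:R^-1 =
    (\sum_(s.+1 <= k < n.+1) lcm_upto n %/ k)%:R / (lcm_upto n)%:R :> R.
  rewrite natr_sum mulr_suml; apply: eq_big_nat => k /andP[sk kn].
  have k0 : (0 < k)%N by apply: leq_trans sk.
  rewrite natf_div ?dvdn_lcm_upto ?k0 //.
  by rewrite mulrAC divff // mul1r.
by rewrite /binomial_harmonic !natrM; field; rewrite D0 n0.
Qed.

Lemma clears_denominators_A_poly (R : realType) n d :
  reflect ((0 < d)%N /\ clears n d) (clears_denominators (A_poly R n) d).
Proof.
have V0 : (0 < n`! * lcm_upto n)%N by rewrite muln_gt0 fact_gt0 lcm_upto_gt0.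
have coefE s : (s <= n)%N -> (d%:R *: A_poly R n)`_(n - s) =
    - (Xi_exp R s).1`_0 * ((2 * d * binomial_harmonic n s)%:R / (n`! * lcm_upto n)%:R).
  by move=> sn; rewrite coefZ coef_A_poly // !natrM; ring.
rewrite /clears_denominators; apply: (iffP andP) => -[d0 H]; split=> //.
  move=> s sn es; move/polyOverP/(_ (n - s)%N): H.
  rewrite coefE 1?ltnW // coef0_Xi_exp1 (negbTE es) -(ratio_intE R _ V0).
  by rewrite mulNr rpredN -signr_odd; case: odd; rewrite ?expr1 ?mulN1r ?rpredN ?expr0 ?mul1r.
apply/polyOverP => j; have [jn|nj] := leqP j n; last first.
  by rewrite coefZ coefZ coef_poly ltnNge nj !mulr0 rpred0.
rewrite -(subKn jn) coefE ?leq_subr // coef0_Xi_exp1.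
case: ifP => [_|/negbT es]; first by rewrite oppr0 mul0r rpred0.
apply: rpredM; first by rewrite rpredN rpredX // rpredN rpred1.
rewrite ratio_intE //.
(* The constant coefficient is $s = n$, outside the range of [clears]; its harmonic sum is empty. *)
have [j0|j0] := posnP j; last by apply: H; lia.
by rewrite j0 subn0 /binomial_harmonic big_geq // !muln0 dvdn0.
Qed.

Lemma alpha2_min_clears (R : realType) n :
  [/\ (0 < alpha2 R n)%N, clears n (alpha2 R n) &
      forall b, (0 < b)%N -> clears n b -> (alpha2 R n <= b)%N].
Proof.
(* This witness keeps [denominator] away from its default value 0. *)
have clearsV : clears_denominators (A_poly R n) (n`! * lcm_upto n).
  apply/clears_denominators_A_poly; split.
    by rewrite muln_gt0 fact_gt0 lcm_upto_gt0.
  by move=> s _ _; rewrite -mulnA dvdn_mull // dvdn_mulr.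
rewrite /alpha2 /denominator A2E; case: pselect => [h|[]]; last by exists (n`! * lcm_upto n)%N.
case: ex_minnP => a /clears_denominators_A_poly[a0 ca] amin; split=> // b b0 cb.
by apply: amin; apply/clears_denominators_A_poly.
Qed.
End Denominator.

Theorem corollary5p10 (R : realType) (n : nat) (hn : (1 <= n)%N) :
  ((exists m : nat, (1 <= m)%N /\ n = (2 * 3 ^ m)%N) ->
    logn 3 (alpha2 R n) =
      (logn 3 (n`! * \big[lcmn/1]_(1 <= k < n.+1) k) - 1)%N) /\
  (~ (exists m : nat, (1 <= m)%N /\ n = (2 * 3 ^ m)%N) ->
    logn 3 (alpha2 R n) =
      logn 3 (n`! * \big[lcmn/1]_(1 <= k < n.+1) k)).
Proof.
have [a0 ca amin] := alpha2_min_clears R n.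
exact: logn3_min_clears amin.
Qed.
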